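(* For every $y_j\in T$, let $x_j\in X$ be an optimal solution of $NLP(y_j)$, let $\lambda_{j,i}$, $(\alpha_j,\beta_j)$, $(\xi_{j,i},\eta_{j,i})$ ($i=1,\dots,m$) be KKT data at $(x_j,y_j)$, and let $\rho_j$ be the corresponding parameter. For every $y_l\in S$, let $x_l\in X$ be (the $x$-component of) an optimal solution of the feasibility problem $F(y_l)$, and let $\lambda_{l,i}$, $(\xi_{l,i},\eta_{l,i})$ ($i=1,\dots,m$) be feasibility-problem KKT data at $(x_l,y_l)$. (All these notions are defined in the context.) Consider the master program $$(MP)\quad \left\{\begin{aligned} \min_{x,y,\theta}\ & \theta\\ \text{s.t.}\ & f(x_j,y_j)+(\alpha_j,\beta_j)^T\begin{pmatrix}x-x_j\\ y-y_j\end{pmatrix}\le \theta \quad \forall y_j\in T,\\ & g_i(x_j,y_j)+\rho_j(\xi_{j,i},\eta_{j,i})^T\begin{pmatrix}x-x_j\\ y-y_j\end{pmatrix}\le 0\quad \forall i\in\{1,\dots,m\},\ \forall y_j\in T,\\ & g_i(x_l,y_l)+(\xi_{l,i},\eta_{l,i})^T\begin{pmatrix}x-x_l\\ y-y_l\end{pmatrix}\le 0\quad \forall i\in\{1,\dots,m\},\ \forall y_l\in S,\\ & x\in X,\ y\in Y\cap\mathbb{Z}^p,\ \theta\in\mathbb{R}. \end{aligned}\right.$$ Then $(MP)$ is equivalent to problem $(P)$ in the following sense: both problems have the same optimal value, and if $(\bar x,\bar y)$ is an optimal solution of $(P)$, then $(\bar x,\bar y,\bar\theta)$ with $\bar\theta=f(\bar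 x,\bar y)$ is an optimal solution of $(MP)$.
   Context: Setting. $f,g_i:\mathbb{R}^n\times\mathbb{R}^p\to\mathbb{R}$ ($i=1,\dots,m$) are continuous convex functions, $X\subseteq\mathbb{R}^n$ is a nonempty bounded polyhedral set, $Y\subseteq\mathbb{R}^p$ is a polyhedral set. Problem $(P)$ is: minimize $f(x,y)$ subject to $g_i(x,y)\le 0$ ($i=1,\dots,m$), $x\in X$, $y\in Y\cap\mathbb{Z}^p$. For fixed $y\in Y\cap\mathbb{Z}^p$, $NLP(y)$ is: minimize $f(x,y)$ over $x$ subject to $g_i(x,y)\le 0$ ($i=1,\dots,m$), $x\in X$. Let $T$ (resp. $S$) be the set of $y\in Y\cap\mathbb{Z}^p$ for which $NLP(y)$ is feasible (resp. infeasible). Optimal values are infima, equal to $+\infty$ for infeasible problems. Standing assumption (Slater): for every $y\in T$ there is $\hat x\in X$ with $g_i(\hat x,y)<0$ for all $i=1,\dots,m$. Notation. $N(X,x)=\{\gamma\in\mathbb{R}^n:\langle\gamma,u-x\rangle\le 0\ \forall u\in X\}$ is the normal cone; $\partial$ is the convex subdifferential; $\partial f(\cdot,y)(x)$ is the subdifferential at $x$ of $u\mapsto f(u,y)$, while $\partial f(x,y)$ is the subdifferential of $f$ in the joint variable (similarly for $g_i$). KKT data at $(x_j,y_j)$, where $y_j\in T$ and $x_j$ solves $NLP(y_j)$: multipliers $\lambda_{j,i}\ge 0$ and vectors $(\alpha_j,\beta_j)\in\partial f(x_j,y_j)$, $(\xi_{j,i},\eta_{j,i})\in\partial g_i(x_j,y_j)$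 ($i=1,\dots,m$) such that $\lambda_{j,i}g_i(x_j,y_j)=0$ for all $i$ and $-\alpha_j-\sum_{i=1}^m\lambda_{j,i}\xi_{j,i}\in N(X,x_j)$. (Consequently $\alpha_j\in\partial f(\cdot,y_j)(x_j)$ and $\xi_{j,i}\in\partial g_i(\cdot,y_j)(x_j)$.) Parameter $\rho_j$: let $I(x_j)=\{i:g_i(x_j,y_j)=0\}$ and $J(x_j)=\{1,\dots,m\}\setminus I(x_j)$. If $J(x_j)\neq\emptyset$, put $$\Pi_j:=\max_{i\in J(x_j)}\ \max_{(x,y)\in X\times(Y\cap\mathbb{Z}^p)}(\xi_{j,i},\eta_{j,i})^T\begin{pmatrix}x-x_j\\ y-y_j\end{pmatrix},$$ this maximum being assumed to exist (finite). Then $\rho_j:=\dfrac{-\max_{i\in J(x_j)}g_i(x_j,y_j)}{\Pi_j}$ if $J(x_j)\ne\emptyset$ and $\Pi_j>0$, and $\rho_j:=1$ otherwise. Feasibility problem $F(y_l)$ for $y_l\in S$: minimize $\sum_{i=1}^m u_i$ over $(x,u)\in X\times\mathbb{R}^m$ subject to $g_i(x,y_l)\le u_i$, $u_i\ge 0$ ($i=1,\dots,m$). Feasibility-problem KKT data at $(x_l,y_l)$, where $x_l$ solves $F(y_l)$: multipliers $\lambda_{l,i}$ with $\lambda_{l,i}=0$ if $g_i(x_l,y_l)<0$, $\lambda_{l,i}=1$ if $g_i(x_l,y_l)>0$, $\lambda_{l,i}\in[0,1]$ if $g_i(x_l,y_l)=0$, and vectors $(\xi_{l,i},\eta_{l,i})\in\partial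 g_i(x_l,y_l)$ ($i=1,\dots,m$) such that $-\sum_{i=1}^m\lambda_{l,i}\xi_{l,i}\in N(X,x_l)$. *)

(* Defs.v *)
From mathcomp Require Import all_boot all_order all_algebra.
From mathcomp Require Import all_classical all_reals all_analysis.

Set Implicit Arguments.
Unset Strict Implicit.
Unset Printing Implicit Defensive.

Import Order.TTheory GRing.Theory Num.Theory.
Import numFieldNormedType.Exports.

Local Open Scope classical_set_scope.
Local Open Scope ring_scope.

Definition dotv (R : realType) (n : nat) (u v : 'rV[R]_n) : R :=
  \sum_(k < n) u 0 k * v 0 k.

Definition dotp (R : realType) (n p : nat)
    (s z : 'rV[R]_n * 'rV[R]_p) : R :=
  dotv s.1 z.1 + dotv s.2 z.2.

Definition polyhedral (R : realType) (n : nat) (P : set 'rV[R]_n) : Prop :=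
  exists (k : nat) (a : 'I_k -> 'rV[R]_n) (b : 'I_k -> R),
    P = [set x | forall i, dotv (a i) x <= b i].

Definition integral_points (R : realType) (p : nat) : set 'rV[R]_p :=
  [set y | forall k, y 0 k \is a Num.int].

Definition normal_cone (R : realType) (n : nat) (X : set 'rV[R]_n)
    (x : 'rV[R]_n) : set 'rV[R]_n :=
  [set c | forall u, X u -> dotv c (u - x) <= 0].

Definition subdifferential (R : realType) (n p : nat)
    (h : 'rV[R]_n * 'rV[R]_p -> R) (z : 'rV[R]_n * 'rV[R]_p) :
    set ('rV[R]_n * 'rV[R]_p) :=
  [set s | forall w, h z + dotp s (w - z) <= h w].

(* [ereal_inf set0 = +oo], so infeasible problems have value [+oo]. *)
Definition opt_value (R : realType) (U : Type) (F : set U) (obj : U -> R) :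
    \bar R :=
  ereal_inf [set (obj z)%:E | z in F].

Definition opt_sol (R : realType) (U : Type) (F : set U) (obj : U -> R)
    (z : U) : Prop :=
  F z /\ forall w, F w -> obj z <= obj w.

Definition has_maximum (R : realType) (A : set R) : Prop :=
  exists2 v, A v & ubound A v.

Definition P_feasible (R : realType) (n p m : nat)
    (g : 'I_m -> 'rV[R]_n * 'rV[R]_p -> R)
    (X : set 'rV[R]_n) (Y : set 'rV[R]_p) : set ('rV[R]_n * 'rV[R]_p) :=
  [set z | [/\ forall i, g i z <= 0, X z.1 &
               (Y `&` @integral_points R p) z.2]].

Definition NLP_feasible (R : realType) (n p m : nat)
    (g : 'I_m -> 'rV[R]_n * 'rV[R]_p -> R)
    (X : set 'rV[R]_n) (y : 'rV[R]_p) : set 'rV[R]_n :=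
  [set x | (forall i, g i (x, y) <= 0) /\ X x].

Definition feasible_y (R : realType) (n p m : nat)
    (g : 'I_m -> 'rV[R]_n * 'rV[R]_p -> R)
    (X : set 'rV[R]_n) (Y : set 'rV[R]_p) : set 'rV[R]_p :=
  [set y | (Y `&` @integral_points R p) y /\ NLP_feasible g X y !=set0].

Definition infeasible_y (R : realType) (n p m : nat)
    (g : 'I_m -> 'rV[R]_n * 'rV[R]_p -> R)
    (X : set 'rV[R]_n) (Y : set 'rV[R]_p) : set 'rV[R]_p :=
  [set y | (Y `&` @integral_points R p) y /\ NLP_feasible g X y = set0].

Definition slater (R : realType) (n p m : nat)
    (g : 'I_m -> 'rV[R]_n * 'rV[R]_p -> R)
    (X : set 'rV[R]_n) (Y : set 'rV[R]_p) : Prop :=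
  forall y, feasible_y g X Y y ->
    exists2 x, X x & forall i, g i (x, y) < 0.

(* In the KKT conditions, [ab] is the subgradient (alpha, beta) of the
   objective and [xe i] is the subgradient (xi_i, eta_i) of [g i]. *)
Definition NLP_KKT (R : realType) (n p m : nat)
    (f : 'rV[R]_n * 'rV[R]_p -> R) (g : 'I_m -> 'rV[R]_n * 'rV[R]_p -> R)
    (X : set 'rV[R]_n) (x : 'rV[R]_n) (y : 'rV[R]_p)
    (lam : 'I_m -> R) (ab : 'rV[R]_n * 'rV[R]_p)
    (xe : 'I_m -> 'rV[R]_n * 'rV[R]_p) : Prop :=
  [/\ forall i, 0 <= lam i,
      subdifferential f (x, y) ab,
      forall i, subdifferential (g i) (x, y) (xe i),
      forall i, lam i * g i (x, y) = 0 &
      normal_cone X x (- ab.1 - \sum_(i < m) lam i *: (xe i).1)].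

Definition F_feasible (R : realType) (n p m : nat)
    (g : 'I_m -> 'rV[R]_n * 'rV[R]_p -> R)
    (X : set 'rV[R]_n) (y : 'rV[R]_p) : set ('rV[R]_n * 'rV[R]_m) :=
  [set xu : 'rV[R]_n * 'rV[R]_m | X xu.1 /\
            forall i, g i (xu.1, y) <= xu.2 0 i /\ 0 <= xu.2 0 i].

Definition F_objective (R : realType) (n m : nat)
    (xu : 'rV[R]_n * 'rV[R]_m) : R :=
  \sum_(i < m) xu.2 0 i.

Definition F_KKT (R : realType) (n p m : nat)
    (g : 'I_m -> 'rV[R]_n * 'rV[R]_p -> R)
    (X : set 'rV[R]_n) (x : 'rV[R]_n) (y : 'rV[R]_p)
    (lam : 'I_m -> R) (xe : 'I_m -> 'rV[R]_n * 'rV[R]_p) : Prop :=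
  [/\ forall i, g i (x, y) < 0 -> lam i = 0,
      forall i, 0 < g i (x, y) -> lam i = 1,
      forall i, g i (x, y) = 0 -> 0 <= lam i <= 1,
      forall i, subdifferential (g i) (x, y) (xe i) &
      normal_cone X x (- \sum_(i < m) lam i *: (xe i).1)].

Definition inactive (R : realType) (n p m : nat)
    (g : 'I_m -> 'rV[R]_n * 'rV[R]_p -> R) (z : 'rV[R]_n * 'rV[R]_p) :
    set 'I_m :=
  [set i | g i z <> 0].

Definition cut_values (R : realType) (n p : nat)
    (X : set 'rV[R]_n) (Y : set 'rV[R]_p)
    (z s : 'rV[R]_n * 'rV[R]_p) : set R :=
  [set dotp s (w - z) | w in X `*` (Y `&` @integral_points R p)].

Definition Pi_exists (R : realType) (n p m : nat)
    (g : 'I_m -> 'rV[R]_n * 'rV[R]_p -> R)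
    (X : set 'rV[R]_n) (Y : set 'rV[R]_p) (z : 'rV[R]_n * 'rV[R]_p)
    (xe : 'I_m -> 'rV[R]_n * 'rV[R]_p) : Prop :=
  forall i, inactive g z i -> has_maximum (cut_values X Y z (xe i)).

(* When [Pi_exists] holds and some index is inactive, both suprema are
   attained, so this is the iterated maximum; otherwise it is a junk value. *)
Definition Pi_max (R : realType) (n p m : nat)
    (g : 'I_m -> 'rV[R]_n * 'rV[R]_p -> R)
    (X : set 'rV[R]_n) (Y : set 'rV[R]_p) (z : 'rV[R]_n * 'rV[R]_p)
    (xe : 'I_m -> 'rV[R]_n * 'rV[R]_p) : R :=
  sup [set sup (cut_values X Y z (xe i)) | i in inactive g z].

(* [sup [set g i z | i in inactive g z]] is the maximum of a finite set. *)
Definition rho (R : realType) (n p m : nat)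
    (g : 'I_m -> 'rV[R]_n * 'rV[R]_p -> R)
    (X : set 'rV[R]_n) (Y : set 'rV[R]_p) (z : 'rV[R]_n * 'rV[R]_p)
    (xe : 'I_m -> 'rV[R]_n * 'rV[R]_p) : R :=
  if `[< inactive g z !=set0 /\ 0 < Pi_max g X Y z xe >]
  then - sup [set g i z | i in inactive g z] / Pi_max g X Y z xe
  else 1.

(* A point of the master program is [((x, y), theta)]. The families [xT],
   [abT], [xeT] are only used on the feasible set of integer points, and
   [xS], [xeS] only on the infeasible one. *)
Definition MP_feasible (R : realType) (n p m : nat)
    (f : 'rV[R]_n * 'rV[R]_p -> R) (g : 'I_m -> 'rV[R]_n * 'rV[R]_p -> R)
    (X : set 'rV[R]_n) (Y : set 'rV[R]_p)
    (xT : 'rV[R]_p -> 'rV[R]_n)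
    (abT : 'rV[R]_p -> 'rV[R]_n * 'rV[R]_p)
    (xeT : 'rV[R]_p -> 'I_m -> 'rV[R]_n * 'rV[R]_p)
    (xS : 'rV[R]_p -> 'rV[R]_n)
    (xeS : 'rV[R]_p -> 'I_m -> 'rV[R]_n * 'rV[R]_p) :
    set (('rV[R]_n * 'rV[R]_p) * R) :=
  [set zt |
    [/\ forall y, feasible_y g X Y y ->
          f (xT y, y) + dotp (abT y) (zt.1 - (xT y, y)) <= zt.2,
        forall i y, feasible_y g X Y y ->
          g i (xT y, y)
            + rho g X Y (xT y, y) (xeT y)
              * dotp (xeT y i) (zt.1 - (xT y, y)) <= 0,
        forall i y, infeasible_y g X Y y ->
          g i (xS y, y) + dotp (xeS y i) (zt.1 - (xS y, y)) <= 0,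
        X zt.1.1 &
        (Y `&` @integral_points R p) zt.1.2]].

(* Main.v *)
(** A point [(x, y)] feasible for [(P)] satisfies every cut: each cut is a
    subgradient minorant, and the scaling [rho] is chosen so that a cut of an
    inactive constraint stays below [0] on all of [X * (Y /\ Z^p)].
    Conversely, if [(x, y, theta)] is feasible for [(MP)], weight the cuts
    generated at this same [y] by the multipliers.  If [y] were in [S], the
    normal cone condition would make the sum of the positive parts of the
    [g_i] nonpositive, contradicting infeasibility.  So [y] is in [T], and the
    normal cone condition gives [f (x_y, y) <= theta]; only [rho > 0] is used
    here, as complementarity kills the inactive constraints. *)
Require Import Defs.
From mathcomp Require Import all_boot all_order all_algebra.
From mathcomp Require Import all_classical all_reals all_analysis.
From mathcomp Require Import lra.

Import Order.TTheory GRing.Theory Num.Theory.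
Import numFieldNormedType.Exports.

Local Open Scope classical_set_scope.
Local Open Scope ring_scope.

Set Implicit Arguments.
Unset Strict Implicit.
Unset Printing Implicit Defensive.

Lemma dotv_subr_suml (R : realType) (n m : nat) (a : 'rV[R]_n)
    (lam : 'I_m -> R) (xi : 'I_m -> 'rV[R]_n) (d : 'rV[R]_n) :
  dotv (a - \sum_(i < m) lam i *: xi i) d
    = dotv a d - \sum_(i < m) lam i * dotv (xi i) d.
Proof.
rewrite /dotv.
under [X in _ = _ - X]eq_bigr do rewrite mulr_sumr.
rewrite exchange_big /= -sumrB; apply: eq_bigr => k _.
rewrite !mxE summxE mulrBl mulr_suml; congr (_ - _).
by apply: eq_bigr => i _; rewrite mxE mulrA.
Qed.

Lemma dotvNl (R : realType) (n : nat) (a d : 'rV[R]_n) :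
  dotv (- a) d = - dotv a d.
Proof. by rewrite /dotv -sumrN; apply: eq_bigr => k _; rewrite mxE mulNr. Qed.

Lemma dotv0l (R : realType) (n : nat) (d : 'rV[R]_n) : dotv 0 d = 0.
Proof. by rewrite /dotv big1 // => k _; rewrite mxE mul0r. Qed.

Lemma dotp_same_snd (R : realType) (n p : nat) (s : 'rV[R]_n * 'rV[R]_p)
    (x x' : 'rV[R]_n) (y : 'rV[R]_p) :
  dotp s ((x, y) - (x', y)) = dotv s.1 (x - x').
Proof.
rewrite /dotp /= subrr -[RHS]addr0; congr (_ + _).
by rewrite /dotv big1 // => k _; rewrite mxE mulr0.
Qed.

(** The maxima inside [rho] and [Pi_max] are encoded by [sup]; this gives back their attainment and
    their bound. *)
Lemma has_maximum_sup (R : realType) (A : set R) :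
  has_maximum A -> A (sup A) /\ ubound A (sup A).
Proof.
case=> v Av ubv; suff -> : sup A = v by [].
apply/eqP; rewrite eq_le; apply/andP; split.
  by apply: ge_sup => //; exists v.
by apply: ub_le_sup => //; exists v.
Qed.

Lemma has_maximum_image (R : realType) (I : finType) (A : set I) (F : I -> R) :
  A !=set0 -> has_maximum [set F i | i in A].
Proof.
case=> i0 Ai0; have Pi0 : i0 \in A by rewrite inE.
case: (Order.TotalTheory.arg_maxP F Pi0) => i Ai maxi.
exists (F i); first by exists i => //; rewrite inE in Ai.
by move=> _ [j Aj <-]; apply: maxi; rewrite inE.
Qed.

Section Rho.
Variables (R : realType) (n p m : nat).
Variables (g : 'I_m -> 'rV[R]_n * 'rV[R]_p -> R).
Variables (X : set 'rV[R]_n) (Y : set 'rV[R]_p).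
Variables (z : 'rV[R]_n * 'rV[R]_p) (xe : 'I_m -> 'rV[R]_n * 'rV[R]_p).
Hypothesis g_le0 : forall i, g i z <= 0.

(** In the quotient case, the numerator is attained at an inactive index, where [g] is nonpositive
    and nonzero, hence negative. *)
Lemma rho_gt0 : 0 < rho g X Y z xe.
Proof.
rewrite /rho; case: asboolP => [[J0 Pi0]|_]; last exact: ltr01.
rewrite divr_gt0 // oppr_gt0.
have [[i gi <-] _] := has_maximum_sup (has_maximum_image (g ^~ z) J0).
by rewrite lt_neqAle g_le0 andbT; apply/eqP.
Qed.

Lemma Pi_max_ub i w : Pi_exists g X Y z xe -> inactive g z i ->
  X w.1 -> (Y `&` @integral_points R p) w.2 ->
  dotp (xe i) (w - z) <= Pi_max g X Y z xe.
Proof.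
move=> hPi Ji Xw Yw; have J0 : inactive g z !=set0 by exists i.
have [_ ub] := has_maximum_sup
  (has_maximum_image (fun i => sup (cut_values X Y z (xe i))) J0).
apply: le_trans (ub _ (ex_intro2 _ _ i Ji erefl)).
by have [_] := has_maximum_sup (hPi i Ji); apply; exists w.
Qed.

(** Let [d] be the value of [dotp (xe i) (w - z)]. If [d <= 0], both terms are nonpositive. If
    [d > 0], the subgradient inequality excludes [g i z = 0], so [i] is inactive and [d] is at most
    [Pi_max]. *)
Lemma rho_cut_valid i w : Pi_exists g X Y z xe ->
  subdifferential (g i) z (xe i) ->
  X w.1 -> (Y `&` @integral_points R p) w.2 -> g i w <= 0 ->
  g i z + rho g X Y z xe * dotp (xe i) (w - z) <= 0.
Proof.
move=> hPi sub Xw Yw gw; have cut := le_trans (sub w) gw.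
have [d0|d0] := leP (dotp (xe i) (w - z)) 0.
  by rewrite -[leRHS]addr0 lerD // mulr_ge0_le0 // ltW // rho_gt0.
have [gz0|Ji] := eqVneq (g i z) 0.
  by move: cut; rewrite gz0 add0r leNgt d0.
move/eqP in Ji; have dPi := Pi_max_ub hPi Ji Xw Yw.
have Pi0 := lt_le_trans d0 dPi.
have J0 : inactive g z !=set0 by exists i.
rewrite /rho asboolT //.
have [_ ub] := has_maximum_sup (has_maximum_image (g ^~ z) J0).
have gi_le := ub _ (ex_intro2 _ _ i Ji erefl).
(* This sign turns [d / Pi_max <= 1] into [s <= s * (d / Pi_max)] for the supremum [s], which itself
   dominates [g i z]. *)
have s_le0 : sup [set g j z | j in inactive g z] <= 0.
  by apply: ge_sup => [|_ [j _ <-]] //; exists (g i z), i.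
rewrite -mulrA addrC mulNr addrC subr_le0 (le_trans gi_le) //.
by rewrite -[leLHS]mulr1 ler_wnM2l // mulrC ler_pdivrMr // mul1r.
Qed.

End Rho.

(** All points share [y], so only the [x]-parts of the subgradients act. Testing the normal cone at
    [u] bounds the slope of the objective cut below by minus the weighted sum of the constraint
    slopes. *)
Lemma NLP_KKT_cuts_le (R : realType) (n p m : nat)
    (f : 'rV[R]_n * 'rV[R]_p -> R) (g : 'I_m -> 'rV[R]_n * 'rV[R]_p -> R)
    (X : set 'rV[R]_n) (x : 'rV[R]_n) (y : 'rV[R]_p) (lam : 'I_m -> R)
    (ab : 'rV[R]_n * 'rV[R]_p) (xe : 'I_m -> 'rV[R]_n * 'rV[R]_p)
    (r : R) (u : 'rV[R]_n) (t : R) :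
  NLP_KKT f g X x y lam ab xe -> 0 < r -> X u ->
  f (x, y) + dotp ab ((u, y) - (x, y)) <= t ->
  (forall i, g i (x, y) + r * dotp (xe i) ((u, y) - (x, y)) <= 0) ->
  f (x, y) <= t.
Proof.
move=> [lam0 _ _ compl nc] r0 Xu; rewrite dotp_same_snd => fcut gcut.
apply: le_trans fcut; rewrite lerDl.
have := nc u Xu; rewrite dotv_subr_suml dotvNl => ncu.
suff : \sum_(i < m) lam i * dotv (xe i).1 (u - x) <= 0 by lra.
apply: sumr_le0 => i _; have := gcut i; rewrite dotp_same_snd => gcuti.
have [->|li0] := eqVneq (lam i) 0; first by rewrite mul0r.
(* A nonzero multiplier forces [g i (x, y) = 0]; the cut then bounds the slope alone, and [r > 0]
   cancels. *)
have /eqP := compl i; rewrite mulf_eq0 (negbTE li0) => /eqP gi0.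
by move: gcuti; rewrite gi0 add0r pmulr_rle0 // => d0; rewrite mulr_ge0_le0.
Qed.

Lemma F_KKT_cuts_feasible (R : realType) (n p m : nat)
    (g : 'I_m -> 'rV[R]_n * 'rV[R]_p -> R)
    (X : set 'rV[R]_n) (x : 'rV[R]_n) (y : 'rV[R]_p) (lam : 'I_m -> R)
    (xe : 'I_m -> 'rV[R]_n * 'rV[R]_p) (u : 'rV[R]_n) :
  F_KKT g X x y lam xe -> X u ->
  (forall i, g i (x, y) + dotp (xe i) ((u, y) - (x, y)) <= 0) ->
  forall i, g i (x, y) <= 0.
Proof.
move=> [lamN lamP lamZ _ nc] Xu cut i.
have lam0 j : 0 <= lam j.
  by case: (ltgtP (g j (x, y)) 0) => [/lamN|/lamP|/lamZ/andP[]] // ->.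
(* Each product is the positive part of [g j (x, y)], so one violated constraint makes the sum
   positive, while the weighted cuts and the normal cone force it to be nonpositive. *)
have lg0 j : 0 <= lam j * g j (x, y).
  case: (ltgtP (g j (x, y)) 0) => [/lamN|gj|->]; last by rewrite mulr0.
    by move=> ->; rewrite mul0r.
  by rewrite mulr_ge0 // ltW.
rewrite leNgt; apply/negP => gi0.
have := nc u Xu; rewrite -sub0r dotv_subr_suml dotv0l sub0r oppr_le0 => ncu.
have : \sum_(j < m) lam j * g j (x, y)
    + \sum_(j < m) lam j * dotv (xe j).1 (u - x) <= 0.
  rewrite -big_split sumr_le0 //= => j _; rewrite -mulrDr mulr_ge0_le0 //.
  by have := cut j; rewrite dotp_same_snd.
apply/negP; rewrite -ltNge ltr_wpDr // (bigD1 i) //= ltr_wpDr ?sumr_ge0 //.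
by rewrite lamP // mul1r.
Qed.

Unset Implicit Arguments.
Set Strict Implicit.
Set Printing Implicit Defensive.

Theorem theorem3p2 (R : realType) (n p m : nat)
    (f : 'rV[R]_n * 'rV[R]_p -> R) (g : 'I_m -> 'rV[R]_n * 'rV[R]_p -> R)
    (X : set 'rV[R]_n) (Y : set 'rV[R]_p)
    (f_cont : continuous f) (f_convex : convex_function setT f)
    (g_cont : forall i, continuous (g i))
    (g_convex : forall i, convex_function setT (g i))
    (X_nonempty : X !=set0) (X_bounded : bounded_set X)
    (X_polyhedral : polyhedral X) (Y_polyhedral : polyhedral Y)
    (slater_gX : slater g X Y)
    (xT : 'rV[R]_p -> 'rV[R]_n) (lamT : 'rV[R]_p -> 'I_m -> R)
    (abT : 'rV[R]_p -> 'rV[R]_n * 'rV[R]_p)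
    (xeT : 'rV[R]_p -> 'I_m -> 'rV[R]_n * 'rV[R]_p)
    (xT_opt : forall y, feasible_y g X Y y ->
       opt_sol (NLP_feasible g X y) (fun x => f (x, y)) (xT y))
    (T_KKT : forall y, feasible_y g X Y y ->
       NLP_KKT f g X (xT y) y (lamT y) (abT y) (xeT y))
    (T_Pi : forall y, feasible_y g X Y y ->
       Pi_exists g X Y (xT y, y) (xeT y))
    (xS : 'rV[R]_p -> 'rV[R]_n) (lamS : 'rV[R]_p -> 'I_m -> R)
    (xeS : 'rV[R]_p -> 'I_m -> 'rV[R]_n * 'rV[R]_p)
    (xS_opt : forall y, infeasible_y g X Y y ->
       exists u : 'rV[R]_m,
         opt_sol (F_feasible g X y) (@F_objective R n m) (xS y, u))
    (S_KKT : forall y, infeasible_y g X Y y ->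
       F_KKT g X (xS y) y (lamS y) (xeS y)) :
  opt_value (P_feasible g X Y) f
    = opt_value (MP_feasible f g X Y xT abT xeT xS xeS) snd
  /\ (forall z : 'rV[R]_n * 'rV[R]_p,
        opt_sol (P_feasible g X Y) f z ->
        opt_sol (MP_feasible f g X Y xT abT xeT xS xeS) snd (z, f z)).
Proof.
have P_MP z : P_feasible g X Y z ->
    MP_feasible f g X Y xT abT xeT xS xeS (z, f z).
  move=> [gz Xz Yz]; split => // [y Ty|i y Ty|i y Sy].
  - by have [_ sub _ _ _] := T_KKT y Ty; apply: sub.
  - have [_ _ sub _ _] := T_KKT y Ty; have [[gy _] _] := xT_opt y Ty.
    by apply: rho_cut_valid => //; apply: T_Pi.
  - have [_ _ _ sub _] := S_KKT y Sy.
    exact: le_trans (sub i z) (gz i).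
have MP_P zt : MP_feasible f g X Y xT abT xeT xS xeS zt ->
    exists2 z, P_feasible g X Y z & f z <= zt.2.
  case: zt => [[x y] t] [/= fcut gcut scut Xx Yy].
  have [Ty|/set0P/negP/negPn/eqP N0] := pselect (NLP_feasible g X y !=set0).
    have {}Ty : feasible_y g X Y y by [].
    have [[gy Xy] _] := xT_opt y Ty.
    (* The point [x] may violate some [g i], since the cuts only relax the constraints; hence it is
       replaced by the optimal [xT y]. *)
    exists (xT y, y) => //.
    apply: NLP_KKT_cuts_le (T_KKT y Ty) (rho_gt0 _ _ _ gy) Xx (fcut y Ty) _.
    by move=> i; apply: gcut.
  have Sy : infeasible_y g X Y y by [].
  have [u [[/= XxS _] _]] := xS_opt y Sy.
  have gS := F_KKT_cuts_feasible (S_KKT y Sy) Xx (fun i => scut i y Sy).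
  by have : NLP_feasible g X y (xS y) by []; rewrite N0.
split.
  apply/eqP; rewrite eq_le; apply/andP; split.
    apply: le_ereal_inf_tmp => _ [zt /MP_P[z Pz fz] <-].
    by apply: le_trans (_ : (f z)%:E <= _)%E; rewrite ?lee_fin //;
       apply: ereal_inf_lbound; exists z.
  apply: le_ereal_inf_tmp => _ [z Pz <-].
  by apply: ereal_inf_lbound; exists (z, f z) => //; apply: P_MP.
move=> z [Pz zmin]; split; first exact: P_MP.
by move=> w /MP_P[z' Pz' fz']; apply: le_trans (zmin z' Pz') fz'.
Qed.
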